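(* Let $(S_j)_{j\ge 0}$ be a strictly increasing sequence in $\mathbb{R}$ and let $(d_j)_{j\ge 0}$ be a sequence in $(0,1]$. Let $F:\mathbb{R}\to\mathbb{R}$ be the function built from $(S_j)$ and $(d_j)$ as described in the context. Then, for all $\theta\in\mathbb{R}$, the derivative $\dot F(\theta)$ exists, and $\dot F$ is locally Lipschitz continuous. Moreover, for every integer $j\ge 0$: $F(\theta)\ge \frac{7(S_j-S_0)}{16}-\frac{S_{j+1}-S_j}{8}$ for all $\theta\in(S_j,S_{j+1}]$; $F(S_j)\ge \frac{7(S_j-S_0)}{16}$; and $\dot F(S_j)=-d_j$.
   Context: For $m>0$ and $d,\delta\in(0,1]$ let $$f(\theta;m,d,\delta)=\begin{cases} -d\theta & \theta\in(0,\frac{2-d}{16}m)\\ \frac{8}{m}(\theta-\frac m8)^2-m\frac{-d^2+4d}{32} & \theta\in[\frac{2-d}{16}m,\frac{3}{16}m)\\ -\frac{5m}{16}\exp\left(\frac{5/16}{\theta/m-1/2}+1\right)+m\frac{11+d^2-4d}{32} & \theta\in(\frac{3}{16}m,\frac12 m)\\ m\frac{11+d^2-4d}{32} & \theta=\frac12 m\\ \frac{5m}{16}\exp\left(\frac{-5/16}{\theta/m-1/2}+1\right)+m\frac{11+d^2-4d}{32} & \theta\in(\frac12 m,\frac{13}{16}m)\\ -\frac{8}{m}(\theta-\frac{7m}{8})^2+m\frac{22+d^2-4d}{32} & \theta\in[\frac{13}{16}m,\frac{\delta+14}{16}m)\\ -\delta\theta+m\frac{22+d^2+\delta^2-4d+28\delta}{32}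 & \theta\in[\frac{\delta+14}{16}m,m] \end{cases}$$ extended by continuity to $[0,m]$ (that is, to $\theta=0$ and $\theta=\frac{3}{16}m$). Given $(S_j)_{j\ge0}$ strictly increasing and $(d_j)_{j\ge 0}$ in $(0,1]$, the function $F:\mathbb{R}\to\mathbb{R}$ is defined (recursively in $j$) by $F(\theta)=-d_0(\theta-S_0)$ for $\theta\le S_0$; $F(\theta)=f(\theta-S_0;S_1-S_0,d_0,d_1)$ for $\theta\in(S_0,S_1]$; and $F(\theta)=f(\theta-S_j;S_{j+1}-S_j,d_j,d_{j+1})+F(S_j)$ for $\theta\in(S_j,S_{j+1}]$, $j=1,2,\dots$. A derivative $\dot F$ is locally Lipschitz continuous if it is Lipschitz continuous on every compact set.
   Formalization: If (S_j) is bounded, the construction leaves F undefined at and beyond sup S_j; there, existence of the derivative and its local Lipschitz continuity are stated only on the half-line to the left of sup S_j, which is all of ℝ when (S_j) is unbounded. *)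

(* Defs.v *)
From mathcomp Require Import all_boot all_order all_algebra.
From mathcomp Require Import all_classical all_reals all_analysis.
From mathcomp Require Import ring lra.

Set Implicit Arguments.
Unset Strict Implicit.
Unset Printing Implicit Defensive.

Import Order.TTheory GRing.Theory Num.Theory.
Import numFieldNormedType.Exports.

Local Open Scope classical_set_scope.
Local Open Scope ring_scope.

(* The profile f(theta; m, d, delta) on [0, m]; its values outside [0, m] are
   irrelevant. At theta = 0 and theta = 3m/16 it takes the limit values, which
   here come from the first two branches (see profile0 and
   profile_3_16). *)
Definition profile (R : realType) (m d delta theta : R) : R :=
  if theta < (2 - d) / 16 * m then - (d * theta)
  else if theta <= 3 / 16 * m then
    8 / m * (theta - m / 8) ^+ 2 - m * ((- d ^+ 2 + 4 * d) / 32)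
  else if theta < 1 / 2 * m then
    - (5 * m / 16) * expR ((5 / 16) / (theta / m - 1 / 2) + 1)
      + m * ((11 + d ^+ 2 - 4 * d) / 32)
  else if theta == 1 / 2 * m then m * ((11 + d ^+ 2 - 4 * d) / 32)
  else if theta < 13 / 16 * m then
    5 * m / 16 * expR (- (5 / 16) / (theta / m - 1 / 2) + 1)
      + m * ((11 + d ^+ 2 - 4 * d) / 32)
  else if theta < (delta + 14) / 16 * m then
    - (8 / m) * (theta - 7 * m / 8) ^+ 2
      + m * ((22 + d ^+ 2 - 4 * d) / 32)
  else - (delta * theta)
      + m * ((22 + d ^+ 2 + delta ^+ 2 - 4 * d + 28 * delta) / 32).

Lemma profile0 (R : realType) (m d delta : R) :
  0 < m -> 0 < d <= 1 -> profile m d delta 0 = 0.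
Proof.
move=> m0 /andP[d0 d1]; rewrite /profile ifT ?mulr0 ?oppr0//.
by rewrite mulr_gt0// divr_gt0//; lra.
Qed.

(* The third branch, which defines f on (3m/16, m/2), has the same value at
   3m/16 as the second one. *)
Lemma profile_3_16 (R : realType) (m d delta : R) :
  0 < m -> 0 < d <= 1 ->
  profile m d delta (3 / 16 * m) =
  - (5 * m / 16) * expR ((5 / 16) / (3 / 16 * m / m - 1 / 2) + 1)
      + m * ((11 + d ^+ 2 - 4 * d) / 32).
Proof.
move=> m0 /andP[d0 d1]; rewrite /profile ifF; last first.
  by apply/negbTE; rewrite -leNgt ler_pM2r//; lra.
rewrite lexx mulfK ?gt_eqF//.
have -> : 5 / 16 / (3 / 16 - 1 / 2) + 1 = 0 :> R.
  have -> : 3 / 16 - 1 / 2 = - (5 / 16) :> R by lra.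
  by rewrite invrN mulrN divff ?addNr// gt_eqF// divr_gt0.
by rewrite expR0; field; rewrite gt_eqF.
Qed.

Definition built_from (R : realType) (S d : nat -> R) (F : R -> R) : Prop :=
  [/\ forall theta : R, theta <= S 0%N -> F theta = - d 0%N * (theta - S 0%N),
      forall theta : R, S 0%N < theta <= S 1%N ->
        F theta = profile (S 1%N - S 0%N) (d 0%N) (d 1%N) (theta - S 0%N)
    & forall (j : nat) (theta : R), (0 < j)%N -> S j < theta <= S j.+1 ->
        F theta = profile (S j.+1 - S j) (d j) (d j.+1) (theta - S j)
                  + F (S j)].

Lemma built_from_exists (R : realType) (S d : nat -> R) :
  {homo S : i j / (i < j)%N >-> i < j} ->
  exists F : R -> R, built_from S d F.
Proof.
move=> Sincr.
pose fix G (n : nat) : R -> R := if n is k.+1 then fun theta =>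
    profile (S k.+1 - S k) (d k) (d k.+1) (theta - S k) + G k (S k)
  else fun theta => - d 0%N * (theta - S 0%N).
pose F theta := if pselect (exists j, theta <= S j) is left e
  then G (ex_minn e) theta else 0.
have Smono i j : (i <= j)%N -> S i <= S j.
  by rewrite leq_eqVlt => /predU1P[->//|/Sincr/ltW].
have FE j theta : theta <= S j -> (forall k, (k < j)%N -> S k < theta) ->
    F theta = G j theta.
  move=> thj jmin; rewrite /F; case: pselect => [e|]; last by case; exists j.
  case: ex_minnP => n thn nmin; suff -> : n = j by [].
  apply/eqP; rewrite eqn_leq nmin//= leqNgt; apply/negP => /jmin.
  by rewrite ltNge thn.
have FS j : F (S j) = G j (S j) by apply: FE => // k; exact: Sincr.
have Fj j theta : S j < theta <= S j.+1 ->
    F theta = profile (S j.+1 - S j) (d j) (d j.+1) (theta - S j) + F (S j).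
  move=> /andP[jth thj]; rewrite FS (FE j.+1)// => k.
  by rewrite ltnS => /Smono /le_lt_trans; exact.
exists F; split => [theta th0|theta th01|j theta _]; last exact: Fj.
- exact: (FE 0).
- by rewrite (Fj _ _ th01) FS /= subrr mulr0 addr0.
Qed.

(* The set on which the clauses of built_from determine F, i.e. the union of
   (-oo, S 0] and of all (S j, S j.+1]. It is the whole line exactly when S is
   unbounded; otherwise it is the open half-line to the left of sup S, and
   built_from says nothing about F beyond it. *)
Definition built_dom (R : realType) (S : nat -> R) : set R :=
  [set theta | exists j, theta <= S j].

Lemma built_dom_setT (R : realType) (S : nat -> R) :
  S n @[n --> \oo] --> +oo -> built_dom S = setT.
Proof.
move=> /cvgryPge Sy; apply/seteqP; split => // theta _.
by have [N _ /(_ N (leqnn N))/= NS] := Sy theta; exists N.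
Qed.

(* [lipschitz g x | x in K] asks that |g x - g y| <= M |x - y| on K for all
   large M, i.e. that g is Lipschitz on K for some constant. *)
Definition locally_lipschitz_on (R : realType) (D : set R) (g : R -> R) :=
  forall K : set R, compact K -> K `<=` D -> [lipschitz g x | x in K].

(* Main.v *)
Require Import Defs.
From mathcomp Require Import all_boot all_order all_algebra.
From mathcomp Require Import all_classical all_reals all_analysis.
From mathcomp Require Import ring lra.

(** The regularity statement is local and concerns a function made of explicit
    pieces, so everything rests on a notion of regularity that survives gluing.
    It is the estimate [|f y - f x - g x (y - x)| <= L (y - x)^2] for all [x]
    and [y] in a closed interval ([quad_approx]). It implies that [g] is
    Lipschitz ([quad_approx_slope_lip]) and that [g] is the derivative of [f]
    at interior points ([quad_approx_is_derive]), and two such estimates on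
    adjacent intervals glue as soon as the slopes agree at the common endpoint
    ([quad_approx_glue], [C11_on_glue]).

    After scaling to [m = 1] the profile consists of linear and quadratic
    pieces, for which the estimate is an identity, and of two copies of
    [u |-> a exp (1 - a / u)], extended by [0] at [u = 0], whose second
    derivative is bounded because the exponential decays faster than any power
    ([C11_on_flat_exp]). The slopes match at the break points, so the profile
    satisfies the estimate on [[0, 1]], with end slopes [- d] and [- delta]
    ([C11_on_profile]). Therefore the slopes also match at the points [S j],
    and [F] satisfies the estimate on [[S 0 - M, S n]] for all [M > 0] and [n]
    ([C11_on_built]). Every point, and every compact subset, of the domain lies
    in the interior of such an interval, which gives derivability and the
    Lipschitz property.

    The lower bounds follow by induction on [j] from two facts on the profile
    with [m = 1]: it is at least [- 1 / 8] on [[0, 1]] ([profile_ge]), and its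
    value at [1] is at least [7 / 16] ([profile1_ge]). *)

Import Order.TTheory GRing.Theory Num.Theory.
Import numFieldNormedType.Exports.

Set Implicit Arguments.
Unset Strict Implicit.
Unset Printing Implicit Defensive.

Local Open Scope classical_set_scope.
Local Open Scope ring_scope.

(** * First-order expansions with a quadratic remainder *)

(** [g] is the derivative of [f] on [[a, b]], and is Lipschitz there: this one
    estimate contains both facts, and it still makes sense at the endpoints,
    where a two-sided derivative of [f] is not available. *)
Definition quad_approx (R : realType) (f g : R -> R) (a b L : R) :=
  forall x y, a <= x <= b -> a <= y <= b ->
    `|f y - f x - g x * (y - x)| <= L * (y - x) ^+ 2.

(** Adding the expansion from [x] to [y] and the one from [y] to [x] cancels
    the increments of [f] and leaves [(g y - g x) * (y - x)]. *)
Lemma quad_approx_slope_lip (R : realType) (f g : R -> R) (a b L : R) :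
  quad_approx f g a b L -> forall x y, a <= x <= b -> a <= y <= b ->
  `|g y - g x| <= 2 * L * `|y - x|.
Proof.
move=> fg x y xab yab; have [->|yx] := eqVneq y x; first by rewrite !subrr normr0 mulr0.
have d0 : 0 < `|y - x| by rewrite normr_gt0 subr_eq0.
rewrite -(ler_pM2r d0) -[leRHS]mulrA -normrM -(expr2 `|_|) real_normK ?num_real//.
have := fg x y xab yab; have := fg y x yab xab.
rewrite !ler_norml => /andP[h1 h2] /andP[h3 h4]; apply/andP; split; lra.
Qed.

Lemma quad_approx_le (R : realType) (f g : R -> R) (a b L M : R) :
  L <= M -> quad_approx f g a b L -> quad_approx f g a b M.
Proof.
move=> LM fg x y xab yab; apply: (le_trans (fg x y xab yab)).
by rewrite ler_wpM2r// sqr_ge0.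
Qed.

(** The constant is not degraded by gluing: for [x <= b <= y] the remainder
    from [x] to [y] is the sum of the remainders from [x] to [b] and from [b]
    to [y] and of [(g b - g x) * (y - b)], and
    [L (b - x)^2 + L (y - b)^2 + 2 L (b - x) (y - b) = L (y - x)^2]. *)
Lemma quad_approx_glue (R : realType) (f g : R -> R) (a b c L : R) :
  quad_approx f g a b L -> quad_approx f g b c L -> a <= b -> b <= c ->
  quad_approx f g a c L.
Proof.
move=> fab fbc ab bc x y /andP[ax xc] /andP[ay yc].
have key (u v : R) : `|f b - f u - g u * (b - u)| <= L * (b - u) ^+ 2 ->
    `|f v - f b - g b * (v - b)| <= L * (v - b) ^+ 2 ->
    `|g b - g u| <= 2 * L * `|b - u| -> 0 <= (b - u) * (v - b) ->
    `|f v - f u - g u * (v - u)| <= L * (v - u) ^+ 2.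
  move=> h1 h2 h3 h4.
  have -> : f v - f u - g u * (v - u) = (f b - f u - g u * (b - u)) +
     (f v - f b - g b * (v - b)) + (g b - g u) * (v - b) by ring.
  have -> : L * (v - u) ^+ 2 = L * (b - u) ^+ 2 + L * (v - b) ^+ 2 +
     2 * L * `|(b - u) * (v - b)| by rewrite ger0_norm//; ring.
  rewrite (le_trans (ler_normD _ _))// lerD//.
    by rewrite (le_trans (ler_normD _ _))// lerD.
  by rewrite !normrM mulrA ler_wpM2r.
have bab : a <= b <= b by rewrite ab lexx.
have bbc : b <= b <= c by rewrite bc lexx.
have [xb|bx] := leP x b; have [yb|yb] := leP y b.
- by apply: (fab x y); apply/andP.
- have xab : a <= x <= b by rewrite ax xb.
  have ybc : b <= y <= c by rewrite yc ltW.
  apply: (key x y); [exact: (fab x b)|exact: (fbc b y)| |by apply: mulr_ge0; lra].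
  exact: (quad_approx_slope_lip fab).
- have xbc : b <= x <= c by rewrite xc ltW.
  have yab : a <= y <= b by rewrite ay yb.
  apply: (key x y); [exact: (fbc x b)|exact: (fab b y)| |by apply: mulr_le0; lra].
  exact: (quad_approx_slope_lip fbc).
- by apply: (fbc x y); apply/andP; split=> //; exact: ltW.
Qed.

Lemma quad_approx_is_derive (R : realType) (f g : R -> R) (a b L x : R) :
  quad_approx f g a b L -> a < x < b -> is_derive x 1 f (g x).
Proof.
move=> fg /andP[ax xb].
suff dq : h^-1 *: (f (h *: 1 + x) - f x) @[h --> 0^'] --> g x.
  by split; [apply/cvg_ex; exists (g x)|exact: cvg_lim dq].
pose k := Num.min (x - a) (b - x).
have k0 : 0 < k by rewrite lt_min !subr_gt0 ax.
suff bound (r : R) : 0 < `|r| < k ->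
    `|r^-1 *: (f (r *: 1 + x) - f x) - g x| <= L * `|r|.
  rewrite -[X in _ --> X]add0r.
  under eq_fun => r do rewrite -(subrK (g x) (r^-1 *: _)).
  by apply: cvgD; [exact: cvg_to_0_linear bound|exact: cvg_cst].
move=> /andP[r0]; rewrite lt_min => /andP[rxa rbx].
have xab : a <= x <= b by rewrite !ltW.
have rr := ler_norm r; have := ler_norm (- r); rewrite normrN => rN.
have rab : a <= r + x <= b by apply/andP; split; lra.
have := fg _ _ xab rab; rewrite addrK => h.
rewrite -(ler_pM2r r0) -normrM -[leRHS]mulrA -(expr2 `|_|) real_normK ?num_real//.
apply: le_trans h; rewrite [r *: 1]mulr1 le_eqVlt; apply/orP; left; apply/eqP.
congr `| _ |; rewrite /GRing.scale/=; field.
by rewrite -normr_gt0.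
Qed.

(** Only the end slopes [p] and [q] are exposed, because they are all that has
    to be compared when two pieces are put side by side. *)
Definition C11_on (R : realType) (f : R -> R) (a b p q : R) :=
  exists g L, [/\ 0 <= L, quad_approx f g a b L, g a = p & g b = q].

Lemma eq_C11_on (R : realType) (f h : R -> R) (a b p q : R) :
  (forall x, a <= x <= b -> f x = h x) -> C11_on h a b p q -> C11_on f a b p q.
Proof.
move=> fh [g [L [L0 hg ga gb]]]; exists g, L; split=> // x y xab yab.
by rewrite !fh//; exact: hg.
Qed.

(** The slopes of both sides agree at the common endpoint, so that either may
    be used there; the joined slope is returned with its value at [b] because
    [b] is an interior point, where that value is the derivative. *)
Lemma C11_on_join (R : realType) (f : R -> R) (a b c p q r : R) :
  a <= b -> b < c -> C11_on f a b p q -> C11_on f b c q r ->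
  exists g L, [/\ 0 <= L, quad_approx f g a c L, g a = p, g b = q & g c = r].
Proof.
move=> ab bc [g [L [L0 fg ga gb]]] [h [M [M0 fh hb hc]]].
exists (fun x => if x <= b then g x else h x), (Num.max L M); split.
- by rewrite le_max L0.
- apply: (@quad_approx_glue _ _ _ _ b) => //; last exact: ltW.
  + move=> x y /[dup] xab /andP[_ ->].
    by apply: (quad_approx_le _ fg) => //; rewrite le_max lexx.
  + move=> x y /[dup] xab /andP[bx xc].
    suff -> : (if x <= b then g x else h x) = h x.
      by apply: (quad_approx_le _ fh) => //; rewrite le_max lexx orbT.
    case: ifPn => // xb; have -> : x = b by apply/eqP; rewrite eq_le xb.
    by rewrite gb hb.
- by rewrite ab.
- by rewrite lexx.
- by rewrite leNgt bc.
Qed.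

Lemma C11_on_glue (R : realType) (f : R -> R) (a b c p q r : R) :
  a <= b -> b < c -> C11_on f a b p q -> C11_on f b c q r ->
  C11_on f a c p r.
Proof.
move=> ab bc fab fbc.
have [g [L [L0 fg ga _ gc]]] := C11_on_join ab bc fab fbc.
by exists g, L.
Qed.

Lemma C11_on_derivable (R : realType) (f : R -> R) (a b p q x : R) :
  C11_on f a b p q -> a < x < b -> derivable f x 1.
Proof. by move=> [g [L [_ fg _ _]]] /(quad_approx_is_derive fg) []. Qed.

Lemma C11_on_derive1_join (R : realType) (f : R -> R) (a b c p q r : R) :
  a < b -> b < c -> C11_on f a b p q -> C11_on f b c q r ->
  derive1 f b = q.
Proof.
move=> ab bc fab fbc.
have [g [L [_ fg _ gb _]]] := C11_on_join (ltW ab) bc fab fbc.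
have /(quad_approx_is_derive fg)[_] : a < b < c by rewrite ab.
by rewrite derive1E gb.
Qed.

Lemma C11_on_derive1_lipschitz (R : realType) (f : R -> R) (a b p q : R)
    (K : set R) :
  C11_on f a b p q -> (forall x, K x -> a < x < b) ->
  [lipschitz (derive1 f) x | x in K].
Proof.
move=> [g [L [L0 fg _ _]]] Kab.
have dE x : K x -> derive1 f x = g x.
  by move=> /Kab /(quad_approx_is_derive fg)[_]; rewrite derive1E.
have [->|/set0P[x0 Kx0]] := eqVneq K set0; first exact: lipschitz_set0.
have PF : ProperFilter (globally (K `*` K)).
  exact: (@globally_properfilter _ _ (x0, x0)).
apply: (@klipschitzW _ _ _ (2 * L)).
move=> [x y] [/= Kx Ky]; rewrite !dE//.
apply: (quad_approx_slope_lip fg).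
  by have /andP[/ltW-> /ltW->] := Kab _ Ky.
by have /andP[/ltW-> /ltW->] := Kab _ Kx.
Qed.

Lemma C11_on_affine (R : realType) (f : R -> R) (a b p q c k m : R) :
  0 < m -> C11_on f a b p q ->
  C11_on (fun x => k + m * f ((x - c) / m)) (c + m * a) (c + m * b) p q.
Proof.
move=> m0 [g [L [L0 fg <- <-]]]; have mN0 := lt0r_neq0 m0.
exists (fun x => g ((x - c) / m)), (L / m); split.
- by rewrite divr_ge0// ltW.
- move=> x y xab yab.
  have mv z : c + m * a <= z <= c + m * b -> a <= (z - c) / m <= b.
    by rewrite ler_pdivlMr// ler_pdivrMr// lerBrDr lerBlDr ![_ * m]mulrC ![_ + c]addrC.
  have /(ler_wpM2l (ltW m0)) := fg _ _ (mv _ xab) (mv _ yab).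
  rewrite -{1}(gtr0_norm m0) -normrM.
  have -> : m * (f ((y - c) / m) - f ((x - c) / m) -
      g ((x - c) / m) * ((y - c) / m - (x - c) / m)) =
    k + m * f ((y - c) / m) - (k + m * f ((x - c) / m)) - g ((x - c) / m) * (y - x).
    by field.
  by have -> : m * (L * ((y - c) / m - (x - c) / m) ^+ 2) = L / m * (y - x) ^+ 2 by field.
- by rewrite addrAC subrr add0r mulrAC mulfV// mul1r.
- by rewrite addrAC subrr add0r mulrAC mulfV// mul1r.
Qed.

Lemma C11_on_odd (R : realType) (f : R -> R) (a b p q : R) :
  C11_on f a b p q -> C11_on (fun x => - f (- x)) (- b) (- a) q p.
Proof.
move=> [g [L [L0 fg <- <-]]]; exists (fun x => g (- x)), L; split; rewrite ?opprK//.
move=> x y xab yab.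
have mv z : - b <= z <= - a -> a <= - z <= b by rewrite lerNl lerNr andbC.
have := fg _ _ (mv _ xab) (mv _ yab).
rewrite -normrN.
have -> : - (f (- y) - f (- x) - g (- x) * (- y - - x)) =
   - f (- y) - - f (- x) - g (- x) * (y - x) by ring.
by have -> : (- y - - x) ^+ 2 = (y - x) ^+ 2 by ring.
Qed.

(** The remainder of a quadratic polynomial is exactly [c1 * (y - x) ^+ 2]. *)
Lemma C11_on_quadratic (R : realType) (c1 c2 c3 a b : R) :
  C11_on (fun x => c1 * x ^+ 2 + c2 * x + c3) a b (2 * c1 * a + c2) (2 * c1 * b + c2).
Proof.
exists (fun x => 2 * c1 * x + c2), `|c1|; split=> // x y _ _.
rewrite -[(y - x) ^+ 2]ger0_norm ?sqr_ge0// -normrM le_eqVlt; apply/orP; left.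
by apply/eqP; congr `|_|; ring.
Qed.

(** * The flat exponential *)

(** Up to translations of the graph, the exponential branches of the profile
    with [m = 1] are this function and its odd reflection, for [a = 5 / 16]. *)
Definition flat_exp (R : realType) (a u : R) : R :=
  if u <= 0 then 0 else a * expR (1 - a / u).

(** One term of the exponential series bounds [expR s] from below. *)
Lemma exprn_expRN_le (R : realType) (s : R) (n : nat) :
  0 <= s -> s ^+ n.+1 * expR (- s) <= n.+1`!%:R.
Proof.
move=> s0; rewrite expRN ler_pdivrMr ?expR_gt0// mulrC -ler_pdivrMr ?ltr0n ?fact_gt0//.
by apply: le_trans (expR_ge1Dxn n s0); rewrite lerDr.
Qed.

(** The interval is open because, for the flat exponential, the derivatives at
    [0] exist but the differentiation rules do not provide them. *)
Lemma bounded_slope_lip (R : realType) (g k : R -> R) (a b L : R) :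
  (forall x, a < x < b -> is_derive x 1 g (k x)) ->
  (forall x, a < x < b -> `|k x| <= L) ->
  forall x y, a < x < b -> a < y < b -> `|g y - g x| <= L * `|y - x|.
Proof.
move=> gk kL.
have key x y : a < x < b -> a < y < b -> x < y -> `|g y - g x| <= L * `|y - x|.
  move=> /andP[ax xb] /andP[ay yb] xy.
  have [||z /itvP zxy ->] := @MVT _ g k x y xy.
  - by move=> z /itvP zxy; apply: gk; rewrite (lt_trans ax) ?zxy// (lt_trans _ yb)// zxy.
  - apply: derivable_within_continuous => z /itvP zxy.
    by apply: ex_derive; apply: gk; rewrite (lt_le_trans ax) ?zxy//
      (le_lt_trans _ yb)// zxy.
  rewrite normrM ler_wpM2r// kL//.
  by rewrite (lt_trans ax) ?zxy// (lt_trans _ yb)// zxy.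
move=> x y xab yab; have [xy|yx|->] := ltgtP x y; first exact: key.
  by rewrite distrC (distrC y); exact: key.
by rewrite !subrr !normr0 mulr0.
Qed.

(** By the mean value theorem the remainder is [(g z - g x) * (y - x)] for some
    [z] between [x] and [y], and [g] is Lipschitz. *)
Lemma bounded_slope_quad (R : realType) (f g k : R -> R) (a b L : R) :
  (forall x, a < x < b -> is_derive x 1 f (g x)) ->
  (forall x, a < x < b -> is_derive x 1 g (k x)) ->
  (forall x, a < x < b -> `|k x| <= L) ->
  forall x y, a < x < b -> a < y < b ->
  `|f y - f x - g x * (y - x)| <= L * (y - x) ^+ 2.
Proof.
move=> fg gk kL x y xab yab.
have L0 : 0 <= L by rewrite (le_trans _ (kL x xab)).
have mvt u v : a < u < b -> a < v < b -> u < v ->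
    exists2 z, u < z < v & f v - f u = g z * (v - u).
  move=> /andP[au ub] /andP[av vb] uv.
  have [||z zuv fE] := @MVT _ f g u v uv; last by exists z => //; rewrite !(itvP zuv).
  - by move=> z zuv; apply: fg; rewrite (lt_trans au) ?(lt_trans _ vb)// (itvP zuv).
  - apply: derivable_within_continuous => z zuv; apply: ex_derive; apply: fg.
    by rewrite (lt_le_trans au) ?(le_lt_trans _ vb)// (itvP zuv).
suff [z zab [zxy ->]] : exists2 z, a < z < b &
    `|z - x| <= `|y - x| /\ f y - f x = g z * (y - x).
  rewrite -mulrBl normrM -[(y - x) ^+ 2]ger0_norm ?sqr_ge0// normrX expr2 mulrA.
  rewrite ler_wpM2r// (le_trans (bounded_slope_lip gk kL xab zab))//.
  by rewrite ler_wpM2l.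
have [/andP[ax xb] /andP[ay yb]] := (xab, yab).
have [xy|yx|<-] := ltgtP x y.
- have [z /andP[xz zy] fE] := mvt _ _ xab yab xy; exists z.
    by rewrite (lt_trans ax)// (lt_trans zy).
  by split=> //; rewrite !gtr0_norm ?subr_gt0// lerB// ltW.
- have [z /andP[yz zx] fE] := mvt _ _ yab xab yx; exists z.
    by rewrite (lt_trans ay)// (lt_trans zx).
  split; last by rewrite -opprB fE -mulrN opprB.
  by rewrite !ltr0_norm ?subr_lt0// lerN2 lerB// ltW.
- by exists x => //; rewrite !subrr mulr0.
Qed.

Definition flat_slope (R : realType) (a u : R) : R :=
  if u <= 0 then 0 else (a / u) ^+ 2 * expR (1 - a / u).

Lemma is_derive_expR_inv (R : realType) (a u : R) : u != 0 ->
  is_derive u 1 (fun x : R => expR (1 - a / x)) (a / u ^+ 2 * expR (1 - a / u)).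
Proof.
move=> u0.
have du : is_derive u 1 (fun x : R => 1 - a * x^-1) (a / u ^+ 2).
  have ? : is_derive u 1 (fun x : R => x^-1) (- u ^- 2 *: 1) by exact: is_deriveV.
  apply: is_derive_eq.
  by rewrite /GRing.scale/=; field.
by rewrite mulrC; exact: (is_derive1_comp (is_derive_expR _) du).
Qed.

(** In the variable [s = a / u] the second derivative of the function is
    [(s^4 - 2 s^3) e^(1 - s) / a], which is bounded for [s > 0] because
    [s^n e^(-s) <= n!]: hence the constant [36 e / a], since
    [4! + 2 * 3! = 36]. When one of the two points is [0] the mean value
    theorem does not apply, but there the remainder is explicit and the same
    bounds on [s^n e^(-s)] conclude. *)
Lemma C11_on_flat_exp (R : realType) (a : R) : 0 < a ->
  C11_on (flat_exp a) 0 a 0 1.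
Proof.
move=> a0; pose E := expR 1 : R.
have E0 : 0 < E by exact: expR_gt0.
have aN0 := lt0r_neq0 a0.
have expE (s : R) : expR (1 - s) = E * expR (- s) by rewrite expRD.
have s_gt0 (u : R) : 0 < u -> 0 < a / u by move=> u0; rewrite divr_gt0.
have mono (s : R) n : 0 < s -> 0 <= s ^+ n.+1 * expR (- s) <= n.+1`!%:R.
  move=> s0; have s0' := ltW s0; rewrite exprn_expRN_le// andbT.
  by rewrite mulr_ge0 ?expR_ge0// exprn_ge0.
pose k (u : R) := ((a / u) ^+ 4 - 2 * (a / u) ^+ 3) / a * expR (1 - a / u).
(* The interval ends at [a + 1] so that the endpoint [a] is interior. *)
have df (u : R) : 0 < u < a + 1 -> is_derive u 1 (fun x => a * expR (1 - a / x))
     ((a / u) ^+ 2 * expR (1 - a / u)).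
  move=> /andP[/lt0r_neq0 u0 _]; have ? := is_derive_expR_inv a u0.
  apply: is_derive_eq.
  rewrite /GRing.scale/=; field; exact: u0.
have dg (u : R) : 0 < u < a + 1 ->
    is_derive u 1 (fun x => (a / x) ^+ 2 * expR (1 - a / x)) (k u).
  move=> /andP[/lt0r_neq0 u0 _]; have ? := is_derive_expR_inv a u0.
  have ? : is_derive u 1 (fun x : R => x^-1) (- u ^- 2 *: 1) by exact: is_deriveV.
  apply: is_derive_eq.
  rewrite /k /GRing.scale/=; field; by rewrite u0 aN0.
have kL u : 0 < u < a + 1 -> `|k u| <= 36 * E / a.
  move=> /andP[/s_gt0 u0 _]; rewrite /k expE; set s := a / u in u0 *.
  have /andP[h1 h2] := mono s 3 u0; have /andP[h3 h4] := mono s 2 u0.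
  have -> : (s ^+ 4 - 2 * s ^+ 3) / a * (E * expR (- s)) =
     (s ^+ 4 * expR (- s) - 2 * (s ^+ 3 * expR (- s))) * (E / a) by field.
  have -> : 36 * E / a = 36 * (E / a) by rewrite mulrA.
  rewrite normrM [X in _ * X]gtr0_norm ?divr_gt0// ler_pM2r ?divr_gt0//.
  rewrite ler_norml; move: h2 h4; rewrite !factS fact0 => h2 h4.
  apply/andP; split; lra.
exists (flat_slope a), (36 * E / a); split.
- by rewrite divr_ge0 ?ltW// mulr_gt0.
- move=> x y /andP[x0 xa] /andP[y0 ya]; rewrite /flat_exp /flat_slope.
  have [x0'|x0'] := leP x 0; have [y0'|y0'] := leP y 0.
  + by rewrite !subrr mul0r subr0 normr0 mulr_ge0 ?sqr_ge0// divr_ge0 ?ltW// mulr_gt0.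
  + have -> : x = 0 by lra.
    rewrite mul0r !subr0 expE; have := s_gt0 _ y0'; set s := a / y => s0.
    have /andP[h1 h2] := mono s 1 s0.
    have -> : y = a / s by rewrite /s invf_div mulrCA mulfV// mulr1.
    have -> : a * (E * expR (- s)) = s ^+ 2 * expR (- s) * (a * E / s ^+ 2).
      by field; rewrite lt0r_neq0.
    have -> : 36 * E / a * (a / s) ^+ 2 = 36 * (a * E / s ^+ 2).
      by field; rewrite aN0 lt0r_neq0.
    have p0 : 0 < a * E / s ^+ 2 by apply: divr_gt0; [exact: mulr_gt0|exact: exprn_gt0].
    rewrite ger0_norm; last by rewrite mulr_ge0// ltW.
    rewrite ler_pM2r//.
    by rewrite (le_trans h2)// ler_nat.
  + have -> : y = 0 by lra.
    rewrite !sub0r mulrN opprK sqrrN expE; have := s_gt0 _ x0'; set s := a / x => s0.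
    have /andP[h1 h2] := mono s 1 s0; have /andP[h3 h4] := mono s 2 s0.
    have -> : x = a / s by rewrite /s invf_div mulrCA mulfV// mulr1.
    have -> : - (a * (E * expR (- s))) + s ^+ 2 * (E * expR (- s)) * (a / s) =
      (s ^+ 3 * expR (- s) - s ^+ 2 * expR (- s)) * (a * E / s ^+ 2).
      by field; rewrite lt0r_neq0.
    have -> : 36 * E / a * (a / s) ^+ 2 = 36 * (a * E / s ^+ 2).
      by field; rewrite aN0 lt0r_neq0.
    have p0 : 0 < a * E / s ^+ 2 by apply: divr_gt0; [exact: mulr_gt0|exact: exprn_gt0].
    rewrite normrM (gtr0_norm p0) ler_pM2r// ler_norml.
    move: h2 h4; rewrite !factS fact0 => h2 h4.
    apply/andP; split; lra.
  + by apply: (bounded_slope_quad df dg kL); rewrite ?x0' ?y0'/=; lra.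
- by rewrite /flat_slope lexx.
- by rewrite /flat_slope leNgt a0/= divff// subrr expR0 expr1n mulr1.
Qed.

(** * The profile *)

(** The profile is homogeneous in the pair [(m, theta)], so that its analysis
    reduces to [m = 1]. *)
Lemma profile_scale (R : realType) (m d delta x : R) : 0 < m ->
  profile m d delta x = m * profile 1 d delta (x / m).
Proof.
move=> m0; have mN0 := lt0r_neq0 m0.
have -> : profile m d delta x = profile m d delta (x / m * m) by rewrite divfK.
set t := x / m; rewrite /profile !mulr1 !ltr_pM2r// ler_pM2r//.
rewrite (inj_eq (mulIf mN0)) mulfK// !divr1.
by repeat case: ifP => _; field.
Qed.

(** The two exponential branches for [m = 1] together form a curve that is
    symmetric about the point [(1 / 2, profile_mid d)]. *)
Definition profile_mid (R : realType) (d : R) : R := (11 + d ^+ 2 - 4 * d) / 32.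

(** The six closed forms below hold on closed intervals, endpoints included;
    this is where the continuity of the profile at its break points enters. *)
Lemma profile_piece1 (R : realType) (d delta x : R) :
  0 < d <= 1 -> x <= (2 - d) / 16 -> profile 1 d delta x = - d * x.
Proof.
move=> /andP[d0 d1] xt; rewrite /profile !mulr1; case: ltP => [_|tx].
  by rewrite mulNr.
have -> : x = (2 - d) / 16 by lra.
by rewrite ifT; [field|lra].
Qed.

Lemma profile_piece2 (R : realType) (d delta x : R) :
  (2 - d) / 16 <= x <= 3 / 16 ->
  profile 1 d delta x = 8 * (x - 1 / 8) ^+ 2 - (4 * d - d ^+ 2) / 32.
Proof.
by move=> /andP[tx xt]; rewrite /profile !mulr1 ltNge tx/= xt; field.
Qed.

Lemma profile_piece3 (R : realType) (d delta x : R) :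
  0 < d <= 1 -> 3 / 16 <= x <= 1 / 2 ->
  profile 1 d delta x = profile_mid d - flat_exp (5 / 16) (1 / 2 - x).
Proof.
move=> d01 /andP[tx xt]; have /andP[d0 d1] := d01.
rewrite /flat_exp subr_le0; case: (leP (1 / 2) x) => xh.
  have -> : x = 1 / 2 by lra.
  rewrite /profile !mulr1 ltNge ifF; last by apply/negbTE; lra.
  rewrite ifF; last by apply/negbTE; lra.
  by rewrite ltxx eqxx /profile_mid; field.
have -> : profile 1 d delta x =
    - (5 * 1 / 16) * expR ((5 / 16) / (x / 1 - 1 / 2) + 1)
      + 1 * ((11 + d ^+ 2 - 4 * d) / 32).
  move: tx; rewrite le_eqVlt => /predU1P[<-|tx].
    by have := profile_3_16 delta (ltr01 : 0 < 1 :> R) d01; rewrite (mulr1 (3 / 16)).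
  rewrite /profile !mulr1 ifF; last by apply/negbTE; lra.
  by rewrite ifF ?xh//; apply/negbTE; lra.
rewrite /profile_mid.
have -> : 5 / 16 / (x / 1 - 1 / 2) + 1 = 1 - 5 / 16 / (1 / 2 - x) by field; lra.
by field.
Qed.

Lemma profile_piece4 (R : realType) (d delta x : R) :
  0 < d <= 1 -> 1 / 2 <= x <= 13 / 16 -> 0 < delta ->
  profile 1 d delta x = profile_mid d + flat_exp (5 / 16) (x - 1 / 2).
Proof.
move=> /andP[d0 d1] /andP[tx xt] e0.
rewrite /flat_exp subr_le0; case: (leP x (1 / 2)) => xh.
  have -> : x = 1 / 2 by lra.
  rewrite /profile !mulr1 ltNge ifF; last by apply/negbTE; lra.
  rewrite ifF; last by apply/negbTE; lra.
  by rewrite ltxx eqxx /profile_mid; field.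
rewrite /profile !mulr1 ifF; last by apply/negbTE; lra.
rewrite ifF; last by apply/negbTE; lra.
rewrite ifF; last by apply/negbTE; lra.
rewrite ifF; last by apply/negbTE; rewrite gt_eqF.
case: (ltP x (13 / 16)) => x3.
  by rewrite divr1 /profile_mid mulNr addrC [_ + 1]addrC; congr (_ + _ * _); field.
have -> : x = 13 / 16 by lra.
rewrite ifT; last by lra.
have -> : 13 / 16 - 1 / 2 = 5 / 16 :> R by lra.
have a0 : 5 / 16 != 0 :> R by apply: lt0r_neq0; lra.
by rewrite divff// subrr expR0 /profile_mid; field.
Qed.

Lemma profile_piece5 (R : realType) (d delta x : R) :
  0 < d <= 1 -> 13 / 16 <= x <= (delta + 14) / 16 ->
  profile 1 d delta x = - 8 * (x - 7 / 8) ^+ 2 + (22 + d ^+ 2 - 4 * d) / 32.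
Proof.
move=> /andP[d0 d1] /andP[tx xt].
rewrite /profile !mulr1 ifF; last by apply/negbTE; lra.
rewrite ifF; last by apply/negbTE; lra.
rewrite ifF; last by apply/negbTE; lra.
rewrite ifF; last by apply/negbTE; apply/eqP; lra.
rewrite ifF; last by apply/negbTE; lra.
case: (ltP x ((delta + 14) / 16)) => x4; first by field.
have -> : x = (delta + 14) / 16 by lra.
by field.
Qed.

Lemma profile_piece6 (R : realType) (d delta x : R) :
  0 < d <= 1 -> 0 < delta -> (delta + 14) / 16 <= x ->
  profile 1 d delta x = - delta * x +
    (22 + d ^+ 2 + delta ^+ 2 - 4 * d + 28 * delta) / 32.
Proof.
move=> /andP[d0 d1] e0 tx.
rewrite /profile !mulr1 ifF; last by apply/negbTE; lra.
rewrite ifF; last by apply/negbTE; lra.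
rewrite ifF; last by apply/negbTE; lra.
rewrite ifF; last by apply/negbTE; apply/eqP; lra.
rewrite ifF; last by apply/negbTE; lra.
rewrite ifF; last by apply/negbTE; lra.
by field.
Qed.

(** The slopes at the successive break points are
    [-d, -d, 1, 0, 1, -delta, -delta], and consecutive pieces agree on them. *)
Lemma C11_on_profile (R : realType) (d delta : R) :
  0 < d <= 1 -> 0 < delta <= 1 ->
  C11_on (profile 1 d delta) 0 1 (- d) (- delta).
Proof.
move=> d01 e01; have /andP[d0 d1] := d01; have /andP[e0 e1] := e01.
have a0 : 0 < 5 / 16 :> R by lra.
have flat := C11_on_flat_exp a0.
have P1 : C11_on (profile 1 d delta) 0 ((2 - d) / 16) (- d) (- d).
  apply: (@eq_C11_on _ _ (fun x => 0 * x ^+ 2 + - d * x + 0)).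
    by move=> x /andP[_ xt]; rewrite profile_piece1//; ring.
  have := C11_on_quadratic 0 (- d) 0 0 ((2 - d) / 16).
  by rewrite !mulr0 !mul0r !add0r.
have P2 : C11_on (profile 1 d delta) ((2 - d) / 16) (3 / 16) (- d) 1.
  apply: (@eq_C11_on _ _ (fun x => 8 * x ^+ 2 + - 2 * x +
    (8 * (1 / 8) ^+ 2 - (4 * d - d ^+ 2) / 32))).
    by move=> x xt; rewrite profile_piece2//; field.
  have := C11_on_quadratic 8 (- 2) (8 * (1 / 8) ^+ 2 - (4 * d - d ^+ 2) / 32)
    ((2 - d) / 16) (3 / 16).
  have -> : 2 * 8 * ((2 - d) / 16) + - 2 = - d by field.
  by have -> : 2 * 8 * (3 / 16) + - 2 = 1 :> R by field.
(* On the left of [1 / 2] the flat exponential appears reflected. *)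
have P3 : C11_on (profile 1 d delta) (3 / 16) (1 / 2) 1 0.
  apply: (@eq_C11_on _ _ (fun x => profile_mid d +
      1 * - flat_exp (5 / 16) (- ((x - 1 / 2) / 1)))).
    by move=> x xt; rewrite profile_piece3// (mul1r (- _)) divr1 opprB.
  have := C11_on_affine (1 / 2) (profile_mid d) ltr01 (C11_on_odd flat).
  have -> : 1 / 2 + 1 * - (5 / 16) = 3 / 16 :> R by field.
  by have -> : 1 / 2 + 1 * - 0 = 1 / 2 :> R by field.
have P4 : C11_on (profile 1 d delta) (1 / 2) (13 / 16) 0 1.
  apply: (@eq_C11_on _ _ (fun x => profile_mid d +
      1 * flat_exp (5 / 16) ((x - 1 / 2) / 1))).
    by move=> x xt; rewrite profile_piece4// (mul1r (flat_exp _ _)) divr1.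
  have := C11_on_affine (1 / 2) (profile_mid d) ltr01 flat.
  have -> : 1 / 2 + 1 * (5 / 16) = 13 / 16 :> R by field.
  by have -> : 1 / 2 + 1 * 0 = 1 / 2 :> R by field.
have P5 : C11_on (profile 1 d delta) (13 / 16) ((delta + 14) / 16) 1 (- delta).
  apply: (@eq_C11_on _ _ (fun x => - 8 * x ^+ 2 + 14 * x +
    (- 8 * (7 / 8) ^+ 2 + (22 + d ^+ 2 - 4 * d) / 32))).
    by move=> x xt; rewrite profile_piece5//; field.
  have := C11_on_quadratic (- 8) 14 (- 8 * (7 / 8) ^+ 2 + (22 + d ^+ 2 - 4 * d) / 32)
    (13 / 16) ((delta + 14) / 16).
  have -> : 2 * - 8 * ((delta + 14) / 16) + 14 = - delta by field.
  by have -> : 2 * - 8 * (13 / 16) + 14 = 1 :> R by field.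
have P6 : C11_on (profile 1 d delta) ((delta + 14) / 16) 1 (- delta) (- delta).
  apply: (@eq_C11_on _ _ (fun x => 0 * x ^+ 2 + - delta * x +
    (22 + d ^+ 2 + delta ^+ 2 - 4 * d + 28 * delta) / 32)).
    by move=> x /andP[xt _]; rewrite profile_piece6//; ring.
  have := C11_on_quadratic 0 (- delta)
    ((22 + d ^+ 2 + delta ^+ 2 - 4 * d + 28 * delta) / 32) ((delta + 14) / 16) 1.
  by rewrite !mulr0 !mul0r !add0r.
apply: (C11_on_glue _ _ _ P6); try lra.
apply: (C11_on_glue _ _ _ P5); try lra.
apply: (C11_on_glue _ _ _ P4); try lra.
apply: (C11_on_glue _ _ _ P3); try lra.
apply: (C11_on_glue _ _ P1 P2); lra.
Qed.

(** The true minimum is [(d ^+ 2 - 4 * d) / 32 >= - 3 / 32], at [1 / 8]; the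
    estimate [d ^+ 2 - 4 * d >= - 3] also controls all later pieces. *)
Lemma profile_ge (R : realType) (d delta x : R) :
  0 < d <= 1 -> 0 < delta <= 1 -> 0 <= x <= 1 -> - (1 / 8) <= profile 1 d delta x.
Proof.
move=> d01 e01; have /andP[d0 d1] := d01; have /andP[e0 e1] := e01 => /andP[x0 x1].
(* The difference of the two sides is [(1 - d) * (3 - d)]. *)
have dd : d ^+ 2 - 4 * d >= - 3.
  have : 0 <= (1 - d) * (3 - d) by apply: mulr_ge0; lra.
  by rewrite mulrBl !mulrBr; lra.
have [t1|t1] := leP x ((2 - d) / 16).
  rewrite profile_piece1//; have : d * x <= 1 * x by rewrite ler_wpM2r.
  by lra.
have [t2|t2] := leP x (3 / 16).
  rewrite profile_piece2//; last by rewrite t2 ltW.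
  by have := sqr_ge0 (x - 1 / 8); lra.
have flat_le (u : R) : 0 < u -> u <= 5 / 16 -> flat_exp (5 / 16) u <= 5 / 16.
  move=> u0 u1; rewrite /flat_exp (leNgt u) u0/= -[leRHS]mulr1 ler_wpM2l//.
  by rewrite -[leRHS]expR0 ler_expR subr_le0 ler_pdivlMr// mul1r.
have [t3|t3] := ltP x (1 / 2).
  rewrite profile_piece3//; last by rewrite !ltW.
  have : flat_exp (5 / 16) (1 / 2 - x) <= 5 / 16 by apply: flat_le; lra.
  by rewrite /profile_mid; lra.
have [t4|t4] := leP x (13 / 16).
  rewrite profile_piece4//; last by rewrite t3.
  suff : 0 <= flat_exp (5 / 16) (x - 1 / 2) by rewrite /profile_mid; lra.
  by rewrite /flat_exp; case: ifP => // _; rewrite mulr_ge0 ?expR_ge0//; lra.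
have [t5|t5] := leP x ((delta + 14) / 16).
  rewrite profile_piece5//; last by rewrite t5 ltW.
  suff : (x - 7 / 8) ^+ 2 <= (1 / 16) ^+ 2 by lra.
  by rewrite -subr_ge0 subr_sqr mulr_ge0//; lra.
rewrite profile_piece6//; last exact: ltW.
have : delta * x <= delta * 1 by rewrite ler_wpM2l// ltW.
have : 0 <= delta ^+ 2 by exact: sqr_ge0.
lra.
Qed.

(** The value is [(22 + (d^2 - 4 d) + (delta^2 - 4 delta)) / 32], at least
    [(22 - 3 - 3) / 32 = 1 / 2]. *)
Lemma profile1_ge (R : realType) (d delta : R) :
  0 < d <= 1 -> 0 < delta <= 1 -> 7 / 16 <= profile 1 d delta 1.
Proof.
move=> d01 /andP[e0 e1]; have /andP[d0 d1] := d01.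
rewrite profile_piece6//; last lra.
have : 0 <= (1 - d) * (3 - d) by apply: mulr_ge0; lra.
have : 0 <= (1 - delta) * (3 - delta) by apply: mulr_ge0; lra.
by rewrite !mulrBl !mulrBr; lra.
Qed.

(** * The concatenated function *)

Lemma built_S0 (R : realType) (S d : nat -> R) (F : R -> R)
  (F_built : built_from S d F) :
  F (S 0%N) = 0.
Proof. by case: F_built => F0 _ _; rewrite F0// subrr mulr0. Qed.

(** The left endpoint may be included, and the case [j = 0] is no exception,
    because the profile and [F (S 0)] vanish at the respective starting
    points. *)
Lemma built_on_piece (R : realType) (S d : nat -> R) (F : R -> R)
  (S_incr : {homo S : i j / (i < j)%N >-> i < j})
  (d_range : forall j, 0 < d j <= 1)
  (F_built : built_from S d F) (j : nat) (x : R) :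
  S j <= x <= S j.+1 ->
  F x = F (S j) +
    (S j.+1 - S j) * profile 1 (d j) (d j.+1) ((x - S j) / (S j.+1 - S j)).
Proof.
have gap_gt0 : 0 < S j.+1 - S j by rewrite subr_gt0 S_incr.
move=> /andP[]; rewrite le_eqVlt => /predU1P[<- _|jx xj].
  by rewrite subrr mul0r profile0// mulr0 addr0.
rewrite -profile_scale//; have jxj : S j < x <= S j.+1 by rewrite jx.
case: (F_built) => _ F0 Fj; case: j jxj {gap_gt0 jx xj} => [|j] jxj.
  by rewrite (built_S0 F_built) add0r F0.
by rewrite (Fj j.+1)// addrC.
Qed.

Lemma C11_on_built_piece (R : realType) (S d : nat -> R) (F : R -> R)
  (S_incr : {homo S : i j / (i < j)%N >-> i < j})
  (d_range : forall j, 0 < d j <= 1)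
  (F_built : built_from S d F) (j : nat) :
  C11_on F (S j) (S j.+1) (- d j) (- d j.+1).
Proof.
have gap_gt0 : 0 < S j.+1 - S j by rewrite subr_gt0 S_incr.
apply: eq_C11_on (built_on_piece S_incr d_range F_built (j := j)) _.
have := C11_on_affine (S j) (F (S j)) gap_gt0
  (C11_on_profile (d_range j) (d_range j.+1)).
by rewrite mulr0 addr0 mulr1 (addrC (S j)) subrK.
Qed.

(** The profile of index [n] ends with slope [- d n.+1], the slope with which
    the next one starts; the half-line before [S 0] has slope [- d 0]. *)
Lemma C11_on_built (R : realType) (S d : nat -> R) (F : R -> R)
  (S_incr : {homo S : i j / (i < j)%N >-> i < j})
  (d_range : forall j, 0 < d j <= 1)
  (F_built : built_from S d F) (M : R) (n : nat) :
  0 < M ->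
  C11_on F (S 0%N - M) (S n) (- d 0%N) (- d n).
Proof.
move=> M0; elim: n => [|n IHn]; last first.
  apply: (C11_on_glue _ _ IHn (C11_on_built_piece S_incr d_range F_built n));
    last exact: S_incr.
  have : S 0%N <= S n by case: n {IHn} => // n; exact/ltW/S_incr.
  lra.
apply: (@eq_C11_on _ _ (fun x => 0 * x ^+ 2 + - d 0%N * x + d 0%N * S 0%N)).
  by move=> x /andP[_ xS]; case: F_built => F0 _ _; rewrite F0//; ring.
have := C11_on_quadratic 0 (- d 0%N) (d 0%N * S 0%N) (S 0%N - M) (S 0%N).
by rewrite !mulr0 !mul0r !add0r.
Qed.

Lemma built_knot_ge (R : realType) (S d : nat -> R) (F : R -> R)
  (S_incr : {homo S : i j / (i < j)%N >-> i < j})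
  (d_range : forall j, 0 < d j <= 1)
  (F_built : built_from S d F) (j : nat) :
  7 * (S j - S 0%N) / 16 <= F (S j).
Proof.
elim: j => [|j IHj]; first by rewrite (built_S0 F_built) subrr mulr0 mul0r.
have gap_gt0 : 0 < S j.+1 - S j by rewrite subr_gt0 S_incr.
have Sj : S j <= S j.+1 by rewrite ltW// S_incr.
rewrite (built_on_piece S_incr d_range F_built (j := j)) ?lexx ?Sj// divff ?gt_eqF//.
have : (S j.+1 - S j) * (7 / 16) <=
    (S j.+1 - S j) * profile 1 (d j) (d j.+1) 1.
  by rewrite ler_pM2l//; exact: profile1_ge.
lra.
Qed.

Lemma built_ge (R : realType) (S d : nat -> R) (F : R -> R)
  (S_incr : {homo S : i j / (i < j)%N >-> i < j})
  (d_range : forall j, 0 < d j <= 1)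
  (F_built : built_from S d F) (j : nat) (x : R) :
  S j < x <= S j.+1 ->
  7 * (S j - S 0%N) / 16 - (S j.+1 - S j) / 8 <= F x.
Proof.
have gap_gt0 : 0 < S j.+1 - S j by rewrite subr_gt0 S_incr.
move=> /andP[/ltW jx xj]; rewrite (built_on_piece S_incr d_range F_built (j := j)) ?jx//.
have := built_knot_ge S_incr d_range F_built j.
have : (S j.+1 - S j) * - (1 / 8) <= (S j.+1 - S j) *
    profile 1 (d j) (d j.+1) ((x - S j) / (S j.+1 - S j)).
  rewrite ler_pM2l//; apply: profile_ge => //.
  by rewrite ler_pdivlMr// mul0r subr_ge0 jx/= ler_pdivrMr// mul1r lerB.
lra.
Qed.

(** The greatest element of [K] lies below some [S n], hence strictly below
    [S n.+1]. *)
Lemma compact_built_dom (R : realType) (S : nat -> R)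
  (S_incr : {homo S : i j / (i < j)%N >-> i < j}) (K : set R) :
  compact K -> K `<=` built_dom S ->
  exists M n, 0 < M /\ forall x, K x -> S 0%N - M < x < S n.
Proof.
move=> cK KD; have [->|/set0P K0] := eqVneq K set0; first by exists 1, 0%N.
have [u Ku uK] := compact_EVT_max K0 cK (continuous_subspaceT (fun=> cvg_id)).
have [l Kl lK] := compact_EVT_min K0 cK (continuous_subspaceT (fun=> cvg_id)).
have [n un] : built_dom S u by apply: KD; rewrite inE in Ku.
exists (`|S 0%N - l| + 1), n.+1; split; first by rewrite ltr_wpDl.
move=> x Kx; have /uK ux : x \in K by rewrite inE.
have /lK lx : x \in K by rewrite inE.
have := ler_norm (S 0%N - l); have := S_incr n n.+1 (ltnSn n).
by move=> Sn h; apply/andP; split; lra.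
Qed.

Unset Implicit Arguments.

Theorem proposition3p2 (R : realType) (S d : nat -> R) (F : R -> R)
  (S_incr : {homo S : i j / (i < j)%N >-> i < j})
  (d_range : forall j, 0 < d j <= 1)
  (F_built : built_from S d F) :
  [/\ forall theta : R, built_dom S theta -> derivable F theta 1,
      locally_lipschitz_on (built_dom S) (derive1 F)
    & forall j : nat,
      [/\ forall theta : R, S j < theta <= S j.+1 ->
            7 * (S j - S 0%N) / 16 - (S j.+1 - S j) / 8 <= F theta,
          7 * (S j - S 0%N) / 16 <= F (S j)
        & derive1 F (S j) = - d j]].
Proof.
have F_C11 := C11_on_built S_incr d_range F_built.
split=> [theta thD|K cK KD|j].
- have [M [n [M0 thM]]] : exists M n, 0 < M /\
      forall x, [set theta] x -> S 0%N - M < x < S n.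
    by apply: compact_built_dom => //; [exact: compact_set1|move=> _ ->].
  exact: C11_on_derivable (F_C11 M n M0) (thM _ erefl).
- have [M [n [M0 KM]]] := compact_built_dom S_incr cK KD.
  exact: C11_on_derive1_lipschitz (F_C11 M n M0) KM.
- split; first by move=> theta; exact: (built_ge S_incr d_range F_built).
  + exact: (built_knot_ge S_incr d_range F_built).
  + apply: C11_on_derive1_join (F_C11 1 j ltr01)
      (C11_on_built_piece S_incr d_range F_built j); last exact: S_incr.
    have : S 0%N <= S j by case: j => // j; exact/ltW/S_incr.
    lra.
Qed.
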